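(* Let $(M;\oplus,^-,^\sim,0,1)$ be a representable pseudo MV-algebra. If $M$ is strict (that is, $M$ has a strict square root), then $M$ is strongly atomless.
   Context: A pseudo MV-algebra is an algebra $(M;\oplus,^-,^\sim,0,1)$ of type $(2,1,1,0,0)$ such that, writing $x\odot y:=(y^-\oplus x^-)^\sim$, for all $x,y,z\in M$: (A1) $x\oplus(y\oplus z)=(x\oplus y)\oplus z$; (A2) $x\oplus 0=0\oplus x=x$; (A3) $x\oplus 1=1\oplus x=1$; (A4) $1^-=1^\sim=0$; (A5) $(x^-\oplus y^-)^\sim=(x^\sim\oplus y^\sim)^-$; (A6) $x\oplus(x^\sim\odot y)=y\oplus(y^\sim\odot x)=(x\odot y^-)\oplus y=(y\odot x^-)\oplus x$; (A7) $x\odot(x^-\oplus y)=(x\oplus y^\sim)\odot y$; (A8) $(x^-)^\sim=x$. It is a bounded distributive lattice whose join $x\vee y$ is the common value in (A6) and whose meet $x\wedge y$ is the common value in (A7); $\le$ is the lattice order. Put $x\to y:=x^-\oplus y$ and $x\rightsquigarrow y:=y\oplus x^\sim$. $M$ is representable if it is a subdirect product of linearly ordered pseudo MV-algebras. A map $r:M\to M$ is a square root on $M$ if (Sq1) $r(x)\odot r(x)=x$ for all $x\in M$; (Sq2) for all $x,y\in M$, $y\odot y\le x$ implies $y\le r(x)$; (Sq3) for all $x\in M$, $r(x^-)=r(x)\to r(0)$ and $r(x^\sim)=r(x)\rightsquigarrow r(0)$. A square root $r$ is strict if $r(0)=r(0)^-$. An ideal of $M$ is a non-empty downward closed subset closed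 under $\oplus$. An ideal $I$ is prime if $x\wedge y\in I$ implies $x\in I$ or $y\in I$, and normal if $x\oplus I=I\oplus x$ for all $x\in M$. For a normal ideal $I$, $M/I$ is the quotient pseudo MV-algebra by the congruence $x\sim_I y\iff x\odot y^-,\,y\odot x^-\in I$, and $x/I$ is the class of $x$. An atom is a minimal non-zero element. $M$ is strongly atomless if for each $x\in M\setminus\{0\}$ there is a normal prime ideal $P$ such that $x\notin P$ and $x/P$ is not an atom of $M/P$. *)

(* Defs.v *)
From HB Require Import structures.
From mathcomp Require Import all_boot.
From mathcomp Require Import boolp classical_sets.

Set Implicit Arguments.
Unset Strict Implicit.
Unset Printing Implicit Defensive.

Local Open Scope classical_set_scope.

Declare Scope pmv_scope.
Delimit Scope pmv_scope with pmv.
Local Open Scope pmv_scope.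

Definition odot_of (T : Type) (add : T -> T -> T) (ln rn : T -> T) (x y : T) :=
  rn (add (ln y) (ln x)).

(* [lneg x] is $x^-$ and [rneg x] is $x^\sim$. *)
HB.mixin Record isPseudoMV (M : Type) := {
  pzero : M;
  pone : M;
  oplus : M -> M -> M;
  lneg : M -> M;
  rneg : M -> M;
  oplusA : forall x y z, oplus x (oplus y z) = oplus (oplus x y) z;
  oplusx0 : forall x, oplus x pzero = x;
  oplus0x : forall x, oplus pzero x = x;
  oplusx1 : forall x, oplus x pone = pone;
  oplus1x : forall x, oplus pone x = pone;
  lneg1 : lneg pone = pzero;
  rneg1 : rneg pone = pzero;
  rneg_oplus_lneg : forall x y,
    rneg (oplus (lneg x) (lneg y)) = lneg (oplus (rneg x) (rneg y));
  join_rC : forall x y,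
    oplus x (odot_of oplus lneg rneg (rneg x) y) =
    oplus y (odot_of oplus lneg rneg (rneg y) x);
  join_rl : forall x y,
    oplus y (odot_of oplus lneg rneg (rneg y) x) =
    oplus (odot_of oplus lneg rneg x (lneg y)) y;
  join_lC : forall x y,
    oplus (odot_of oplus lneg rneg x (lneg y)) y =
    oplus (odot_of oplus lneg rneg y (lneg x)) x;
  meet_lr : forall x y,
    odot_of oplus lneg rneg x (oplus (lneg x) y) =
    odot_of oplus lneg rneg (oplus x (rneg y)) y;
  lnegK : forall x, rneg (lneg x) = x
}.

#[short(type="pseudoMVType")]
HB.structure Definition PseudoMV := { M of isPseudoMV M }.

Definition odot (M : pseudoMVType) : M -> M -> M := odot_of oplus lneg rneg.

Notation "0" := pzero : pmv_scope.
Notation "1" := pone : pmv_scope.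
Notation "x ⊕ y" := (oplus x y) (at level 50, left associativity) : pmv_scope.
Notation "x ⊙ y" := (odot x y) (at level 40, left associativity) : pmv_scope.

Section Order.
Context (M : pseudoMVType).
Implicit Types x y a : M.

Definition join x y := x ⊕ (rneg x ⊙ y).
Definition meet x y := x ⊙ (lneg x ⊕ y).
Definition le x y := meet x y = x.
Definition limp x y := lneg x ⊕ y.   (* $x \to y$ *)
Definition rimp x y := y ⊕ rneg x.   (* $x \rightsquigarrow y$ *)

Definition atom a := a <> 0 /\ forall y, le y a -> y <> 0 -> y = a.

End Order.

Notation "x ≤ y" := (le x y) (at level 70, no associativity) : pmv_scope.

Definition linearly_ordered (M : pseudoMVType) := forall x y : M, x ≤ y \/ y ≤ x.

Definition homomorphism (A B : pseudoMVType) (f : A -> B) :=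
  [/\ f 0 = 0, f 1 = 1, {morph f : x y / x ⊕ y >-> x ⊕ y},
      {morph f : x / lneg x >-> lneg x} & {morph f : x / rneg x >-> rneg x}].

Definition representable (M : pseudoMVType) :=
  exists (J : Type) (A : J -> pseudoMVType) (h : M -> forall j, A j),
    [/\ forall j, linearly_ordered (A j),
        forall j, homomorphism (fun x => h x j),
        injective h
      & forall j (a : A j), exists x, h x j = a].

Section SquareRoot.
Context (M : pseudoMVType).
Implicit Types r : M -> M.

Definition square_root r :=
  [/\ forall x, r x ⊙ r x = x,
      forall x y, y ⊙ y ≤ x -> y ≤ r x
    & forall x, r (lneg x) = limp (r x) (r 0) /\
                r (rneg x) = rimp (r x) (r 0)].

Definition strict_square_root r := square_root r /\ r 0 = lneg (r 0).

End SquareRoot.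

Definition strict (M : pseudoMVType) := exists r : M -> M, strict_square_root r.

Section Ideals.
Context (M : pseudoMVType).
Implicit Types I : set M.

Definition ideal I :=
  [/\ I !=set0, forall x y, x ≤ y -> I y -> I x
    & forall x y, I x -> I y -> I (x ⊕ y)].

Definition prime_ideal I :=
  ideal I /\ forall x y, I (meet x y) -> I x \/ I y.

Definition normal I :=
  forall x, [set x ⊕ i | i in I] = [set i ⊕ x | i in I].

Record normalIdeal := NormalIdeal {
  nideal_set :> set M;
  nideal_ideal : ideal nideal_set;
  nideal_normal : normal nideal_set
}.

Definition cong I x y := I (x ⊙ lneg y) /\ I (y ⊙ lneg x).

Definition coset I x : set M := [set y | cong I x y].

Definition quot (I : normalIdeal) := {C : set M | exists x, C = coset I x}.

Definition qclass (I : normalIdeal) x : quot I :=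
  exist _ (coset I x) (ex_intro _ x erefl).

Definition qrepr (I : normalIdeal) (c : quot I) : M := sval (cid (svalP c)).

End Ideals.

Section Theory.
Context (M : pseudoMVType).
Implicit Types x y z : M.

Lemma odotE x y : x ⊙ y = rneg (lneg y ⊕ lneg x). Proof. by []. Qed.

Lemma rnegK x : lneg (rneg x) = x.
Proof.
have := rneg_oplus_lneg x 1.
by rewrite lneg1 rneg1 !oplusx0 lnegK.
Qed.

Lemma lneg0 : lneg 0 = 1 :> M. Proof. by rewrite -rneg1 rnegK. Qed.
Lemma rneg0 : rneg 0 = 1 :> M. Proof. by rewrite -lneg1 lnegK. Qed.

Lemma lneg_odot x y : lneg (x ⊙ y) = lneg y ⊕ lneg x.
Proof. by rewrite odotE rnegK. Qed.

Lemma rneg_odot x y : rneg (x ⊙ y) = rneg y ⊕ rneg x.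
Proof. by rewrite odotE rneg_oplus_lneg lnegK. Qed.

Lemma odotA x y z : x ⊙ (y ⊙ z) = x ⊙ y ⊙ z.
Proof. by rewrite !(odotE _ (_ ⊙ _)) !(odotE _ z) !lneg_odot oplusA. Qed.

Lemma odotx1 x : x ⊙ 1 = x.
Proof. by rewrite odotE lneg1 oplus0x lnegK. Qed.
Lemma odot1x x : 1 ⊙ x = x.
Proof. by rewrite odotE lneg1 oplusx0 lnegK. Qed.
Lemma odotx0 x : x ⊙ 0 = 0.
Proof. by rewrite odotE lneg0 oplus1x rneg1. Qed.
Lemma odot0x x : 0 ⊙ x = 0.
Proof. by rewrite odotE lneg0 oplusx1 rneg1. Qed.

Lemma oplus_rneg x : x ⊕ rneg x = 1.
Proof. by have := join_rC x 1; rewrite -!/(odot _ _) odotx1 oplus1x. Qed.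

Lemma lneg_oplus x : lneg x ⊕ x = 1.
Proof. by have := join_lC x 1; rewrite -!/(odot _ _) odot1x oplusx1. Qed.

Lemma odot_lneg x : x ⊙ lneg x = 0.
Proof. by rewrite odotE lneg_oplus rneg1. Qed.

Lemma rneg_odotx x : rneg x ⊙ x = 0.
Proof. by rewrite odotE rnegK lneg_oplus rneg1. Qed.

Lemma joinE x y : join x y = (x ⊙ lneg y) ⊕ y.
Proof. by rewrite /join /odot join_rC join_rl. Qed.

Lemma joinE' x y : join x y = y ⊕ (rneg y ⊙ x).
Proof. by rewrite /join /odot join_rC. Qed.

Lemma meetE x y : meet x y = (x ⊕ rneg y) ⊙ y.
Proof. by rewrite /meet /odot meet_lr. Qed.

Lemma lnegD x y : lneg (x ⊕ y) = lneg y ⊙ lneg x.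
Proof. by rewrite odotE rneg_oplus_lneg !lnegK. Qed.

Lemma rnegD x y : rneg (x ⊕ y) = rneg y ⊙ rneg x.
Proof. by rewrite odotE !rnegK. Qed.

Lemma meetC x y : meet x y = meet y x.
Proof.
have N (a b : M) : lneg (join a b) = meet (lneg b) (lneg a).
  by rewrite /join lnegD lneg_odot rnegK meetE lnegK.
by rewrite -[x]rnegK -[y]rnegK -!N [in RHS]joinE' /join.
Qed.

Lemma leP x y : x ≤ y <-> x ⊙ lneg y = 0.
Proof.
split=> [<-|xy0]; first by rewrite meetE -odotA odot_lneg odotx0.
have yx1 : y ⊕ rneg x = 1 by rewrite -rneg0 -xy0 rneg_odot lnegK.
by rewrite /le meetC meetE yx1 odot1x.
Qed.

Lemma le_rP x y : x ≤ y <-> rneg y ⊙ x = 0.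
Proof.
split=> [<-|yx0]; first by rewrite meetC /meet odotA rneg_odotx odot0x.
have xy1 : lneg x ⊕ y = 1 by rewrite -lneg0 -yx0 lneg_odot rnegK.
by rewrite /le /meet xy1 odotx1.
Qed.

Lemma le_refl x : x ≤ x. Proof. by apply/leP; exact: odot_lneg. Qed.
Lemma le0x x : 0 ≤ x. Proof. by apply/leP; exact: odot0x. Qed.

Lemma le_odotr z x y : x ≤ y -> x ⊙ z ≤ y ⊙ z.
Proof.
move=> /leP xy; apply/leP; rewrite lneg_odot -odotA -/(meet z (lneg y)).
by rewrite meetC /meet odotA xy odot0x.
Qed.

Lemma le_odotl z x y : x ≤ y -> z ⊙ x ≤ z ⊙ y.
Proof.
move=> /le_rP xy; apply/le_rP; rewrite rneg_odot odotA -meetE.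
by rewrite meetC meetE -odotA xy odotx0.
Qed.

Lemma le_lneg x y : x ≤ y -> lneg y ≤ lneg x.
Proof. by move=> /leP xy; apply/le_rP; rewrite lnegK. Qed.

Lemma le_rneg x y : x ≤ y -> rneg y ≤ rneg x.
Proof. by move=> /le_rP xy; apply/leP; rewrite rnegK. Qed.

Lemma le_trans y x z : x ≤ y -> y ≤ z -> x ≤ z.
Proof.
move=> /leP xy /le_lneg/(le_odotl x); rewrite xy => /leP.
by rewrite lneg0 odotx1 => /leP.
Qed.

Lemma le_oplusr z x y : x ≤ y -> x ⊕ z ≤ y ⊕ z.
Proof.
move=> /le_lneg/(le_odotl (lneg z))/le_rneg.
by rewrite -!lnegD !lnegK.
Qed.

Lemma le_oplusl z x y : x ≤ y -> z ⊕ x ≤ z ⊕ y.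
Proof.
move=> /le_lneg/(le_odotr (lneg z))/le_rneg.
by rewrite -!lnegD !lnegK.
Qed.

Lemma meet_lel x y : meet x y ≤ x.
Proof. by apply/le_rP; rewrite /meet odotA rneg_odotx odot0x. Qed.

Lemma meet_ler x y : meet x y ≤ y.
Proof. by rewrite meetC; exact: meet_lel. Qed.

Lemma le_addl x y : x ≤ x ⊕ y.
Proof. by have := le_oplusl x (le0x y); rewrite oplusx0. Qed.

Lemma le_addr x y : y ≤ x ⊕ y.
Proof. by have := le_oplusr y (le0x x); rewrite oplus0x. Qed.

Lemma odot_addK x y : (x ⊕ y) ⊙ lneg y ≤ x.
Proof. by rewrite -{1}[y]lnegK -meetE; exact: meet_lel. Qed.

Lemma odot_addKl x y : rneg x ⊙ (x ⊕ y) ≤ y.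
Proof. by rewrite -{2}[x]rnegK; exact: meet_ler. Qed.

End Theory.

Section Congruence.
Context (M : pseudoMVType) (N : normalIdeal M).
Implicit Types x y z : M.
Local Notation I := (nideal_set N).

Definition qle x y := exists2 i, I i & x ≤ i ⊕ y.

Lemma ideal_le x y : x ≤ y -> I y -> I x.
Proof. by case: (nideal_ideal N) => _ + _; exact. Qed.

Lemma idealD x y : I x -> I y -> I (x ⊕ y).
Proof. by case: (nideal_ideal N) => _ _; exact. Qed.

Lemma ideal0 : I 0.
Proof. by case: (nideal_ideal N) => -[x Ix] dn _; exact: dn (le0x x) Ix. Qed.

Lemma normal_lr x i : I i -> exists2 j, I j & x ⊕ i = j ⊕ x.
Proof.
move=> Ii; have : [set x ⊕ i | i in I] (x ⊕ i) by exists i.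
by rewrite (nideal_normal N x) => -[j Ij <-]; exists j.
Qed.

Lemma normal_rl x i : I i -> exists2 j, I j & i ⊕ x = x ⊕ j.
Proof.
move=> Ii; have : [set i ⊕ x | i in I] (i ⊕ x) by exists i.
by rewrite -(nideal_normal N x) => -[j Ij <-]; exists j.
Qed.

Lemma qleP x y : qle x y <-> I (x ⊙ lneg y).
Proof.
split=> [[i Ii xiy]|Ixy].
  exact: ideal_le (le_trans (le_odotr _ xiy) (odot_addK _ _)) Ii.
by exists (x ⊙ lneg y) => //; rewrite -joinE; exact: le_addl.
Qed.

Lemma qle_rP x y : qle x y <-> I (rneg y ⊙ x).
Proof.
split=> [[i /(normal_rl y)[j Ij ->] xyj]|/(normal_lr y)[j Ij e]].
  exact: ideal_le (le_trans (le_odotl _ xyj) (odot_addKl _ _)) Ij.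
by exists j => //; rewrite -e -joinE'; exact: le_addl.
Qed.

Lemma qle_refl x : qle x x.
Proof. by exists 0; [exact: ideal0|rewrite oplus0x; exact: le_refl]. Qed.

Lemma qle_trans y x z : qle x y -> qle y z -> qle x z.
Proof.
move=> [i Ii xy] [j Ij yz]; exists (i ⊕ j); first exact: idealD.
by apply: (le_trans xy); rewrite -oplusA; exact: le_oplusl.
Qed.

Lemma qle_oplus x x' y y' : qle x x' -> qle y y' -> qle (x ⊕ y) (x' ⊕ y').
Proof.
move=> [i Ii xi] [j Ij yj]; have [k Ik e] := normal_lr x' Ij.
exists (i ⊕ k); first exact: idealD.
apply: (le_trans (le_oplusr y xi)); apply: (le_trans (le_oplusl _ yj)).
rewrite oplusA -(oplusA i) e !oplusA; exact: le_refl.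
Qed.

Lemma qle_lneg x y : qle x y -> qle (lneg y) (lneg x).
Proof. by move=> /qleP xy; apply/qle_rP; rewrite lnegK. Qed.

Lemma qle_rneg x y : qle x y -> qle (rneg y) (rneg x).
Proof. by move=> /qle_rP xy; apply/qleP; rewrite rnegK. Qed.

Lemma congP x y : cong I x y <-> qle x y /\ qle y x.
Proof. by rewrite /cong !qleP. Qed.

Lemma qclassP x y : qclass N x = qclass N y <-> cong I x y.
Proof.
split=> [[xy]|/congP[xy yx]].
  have : coset I y y by apply/congP; split; exact: qle_refl.
  by rewrite -xy.
apply: eq_exist; apply/seteqP; split=> z /congP[a b]; apply/congP;
  by split; eapply qle_trans; eassumption.
Qed.

Lemma qreprK c : qclass N (qrepr c) = c.
Proof.
case: c => C hC; apply: eq_exist; rewrite /qrepr.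
by case: (cid _) => x /= <-.
Qed.

Lemma qrepr_class x : cong I (qrepr (qclass N x)) x.
Proof. by apply/qclassP; exact: qreprK. Qed.

Lemma qclass_surj (c : quot N) : exists x, c = qclass N x.
Proof. by exists (qrepr c); rewrite qreprK. Qed.

(* Operations act on chosen representatives; qplusE, qlnegE and qrnegE show that
   the choice is irrelevant. *)
Definition q0 := qclass N 0.
Definition q1 := qclass N 1.
Definition qplus (c d : quot N) := qclass N (qrepr c ⊕ qrepr d).
Definition qlneg (c : quot N) := qclass N (lneg (qrepr c)).
Definition qrneg (c : quot N) := qclass N (rneg (qrepr c)).

Lemma qplusE x y : qplus (qclass N x) (qclass N y) = qclass N (x ⊕ y).
Proof.
apply/qclassP/congP; have /congP[? ?] := qrepr_class x.
by have /congP[? ?] := qrepr_class y; split; exact: qle_oplus.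
Qed.

Lemma qlnegE x : qlneg (qclass N x) = qclass N (lneg x).
Proof.
by apply/qclassP/congP; have /congP[? ?] := qrepr_class x; split;
  exact: qle_lneg.
Qed.

Lemma qrnegE x : qrneg (qclass N x) = qclass N (rneg x).
Proof.
by apply/qclassP/congP; have /congP[? ?] := qrepr_class x; split;
  exact: qle_rneg.
Qed.

Lemma qodotE x y :
  odot_of qplus qlneg qrneg (qclass N x) (qclass N y) = qclass N (x ⊙ y).
Proof. by rewrite /odot_of !qlnegE qplusE qrnegE. Qed.

Let qE := (qplusE, qlnegE, qrnegE, qodotE).

Fact qplusA (x y z : quot N) : qplus x (qplus y z) = qplus (qplus x y) z.
Proof.
have [[x' ->] [y' ->] [z' ->]] := And3 (qclass_surj x) (qclass_surj y) (qclass_surj z).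
by rewrite !qE oplusA.
Qed.

Fact qplusx0 (x : quot N) : qplus x q0 = x.
Proof. by have [x' ->] := qclass_surj x; rewrite qE oplusx0. Qed.

Fact qplus0x (x : quot N) : qplus q0 x = x.
Proof. by have [x' ->] := qclass_surj x; rewrite qE oplus0x. Qed.

Fact qplusx1 (x : quot N) : qplus x q1 = q1.
Proof. by have [x' ->] := qclass_surj x; rewrite qE oplusx1. Qed.

Fact qplus1x (x : quot N) : qplus q1 x = q1.
Proof. by have [x' ->] := qclass_surj x; rewrite qE oplus1x. Qed.

Fact qlneg1 : qlneg q1 = q0. Proof. by rewrite qE lneg1. Qed.

Fact qrneg1 : qrneg q1 = q0. Proof. by rewrite qE rneg1. Qed.

Fact qrneg_oplus_lneg (x y : quot N) :
  qrneg (qplus (qlneg x) (qlneg y)) = qlneg (qplus (qrneg x) (qrneg y)).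
Proof.
have [[x' ->] [y' ->]] := conj (qclass_surj x) (qclass_surj y).
by rewrite !qE rneg_oplus_lneg.
Qed.

Fact qjoin_rC (x y : quot N) :
  qplus x (odot_of qplus qlneg qrneg (qrneg x) y) =
  qplus y (odot_of qplus qlneg qrneg (qrneg y) x).
Proof.
have [[x' ->] [y' ->]] := conj (qclass_surj x) (qclass_surj y).
by rewrite !qE; congr qclass; exact: join_rC.
Qed.

Fact qjoin_rl (x y : quot N) :
  qplus y (odot_of qplus qlneg qrneg (qrneg y) x) =
  qplus (odot_of qplus qlneg qrneg x (qlneg y)) y.
Proof.
have [[x' ->] [y' ->]] := conj (qclass_surj x) (qclass_surj y).
by rewrite !qE; congr qclass; exact: join_rl.
Qed.

Fact qjoin_lC (x y : quot N) :
  qplus (odot_of qplus qlneg qrneg x (qlneg y)) y =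
  qplus (odot_of qplus qlneg qrneg y (qlneg x)) x.
Proof.
have [[x' ->] [y' ->]] := conj (qclass_surj x) (qclass_surj y).
by rewrite !qE; congr qclass; exact: join_lC.
Qed.

Fact qmeet_lr (x y : quot N) :
  odot_of qplus qlneg qrneg x (qplus (qlneg x) y) =
  odot_of qplus qlneg qrneg (qplus x (qrneg y)) y.
Proof.
have [[x' ->] [y' ->]] := conj (qclass_surj x) (qclass_surj y).
by rewrite !qE; congr qclass; exact: meet_lr.
Qed.

Fact qlnegK (x : quot N) : qrneg (qlneg x) = x.
Proof. by have [x' ->] := qclass_surj x; rewrite !qE lnegK. Qed.

HB.instance Definition _ := isPseudoMV.Build (quot N)
  qplusA qplusx0 qplus0x qplusx1 qplus1x qlneg1 qrneg1 qrneg_oplus_lneg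
  qjoin_rC qjoin_rl qjoin_lC qmeet_lr qlnegK.

Lemma qclass_homomorphism : homomorphism (qclass N).
Proof.
split=> // [x y|x|x]; [exact/esym/qplusE|exact/esym/qlnegE|exact/esym/qrnegE].
Qed.

End Congruence.

Definition strongly_atomless (M : pseudoMVType) :=
  forall x : M, x <> 0 ->
    exists P : normalIdeal M,
      [/\ prime_ideal P, ~ nideal_set P x & ~ atom (qclass P x)].

(* Main.v *)
(** If [h] is a homomorphism of [M] onto a chain with [h x <> 0], its kernel [P]
is a normal prime ideal missing [x]. In [M/P] put [w = r x / P] and
[s = r 0 / P], so that [s <= w], [s = s^-] and [w ⊙ w = x / P]. The element
[w ⊙ s <= w ⊙ w] equals neither [0] nor [w ⊙ w], since each equality forces
[w = s] and hence [w ⊙ w = s ⊙ s^- = 0]; so [x / P] is not an atom. *)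
Require Import Defs.
From HB Require Import structures.
From mathcomp Require Import all_boot.
From mathcomp Require Import boolp classical_sets.

Set Implicit Arguments.
Unset Strict Implicit.
Unset Printing Implicit Defensive.

Local Open Scope pmv_scope.

Section Order.
Context {M : pseudoMVType}.
Implicit Types x y s w : M.

Lemma le_antisym x y : x ≤ y -> y ≤ x -> x = y.
Proof. by move=> xy yx; rewrite -yx meetC. Qed.

Lemma le0_eq x : x ≤ 0 -> x = 0.
Proof. by move=> x0; apply: le_antisym => //; exact: le0x. Qed.

Lemma join_ler x y : x ≤ y -> join x y = y.
Proof. by move=> /Defs.leP xy; rewrite joinE xy oplus0x. Qed.

Lemma join_lel x y : y ≤ x -> join x y = x.
Proof. by move=> /le_rP yx; rewrite /join yx oplusx0. Qed.

(** Left multiplication by [w] is injective above [lneg w], since [y = lneg w ⊕ (w ⊙ y)] for such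
    [y]. Both [s] and [w] lie there: [lneg w ≤ lneg s = s ≤ w]. *)
Lemma odot_cancel_self_dual s w :
  s = lneg s -> s ≤ w -> w ⊙ s = w ⊙ w -> w = s.
Proof.
move=> sE sw eq_ws; have ws : lneg w ≤ s by rewrite sE; exact: le_lneg.
have <- : join (lneg w) w = w by apply: join_ler; exact: le_trans ws sw.
by rewrite -[RHS](join_ler ws) /join lnegK eq_ws.
Qed.

Lemma odot_self_not_atom s w : s = lneg s -> s ≤ w -> ~ atom (w ⊙ w).
Proof.
move=> sE sw [ww0 ww_min].
have ws : w <> s by move=> wsE; apply: ww0; rewrite wsE {2}sE odot_lneg.
have ws0 : w ⊙ s <> 0.
  (* Self-duality of [s] turns [w ⊙ s = 0] into [w ⊙ lneg s = 0], that is, [w ≤ s]. *)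
  by rewrite {1}sE => /Defs.leP ws_le; apply: ws; exact: le_antisym.
have := ww_min _ (le_odotl w sw) ws0.
by move/(odot_cancel_self_dual sE sw).
Qed.

End Order.

Section Kernel.
Context {A B : pseudoMVType} {f : A -> B}.
Hypothesis fH : homomorphism f.
Implicit Types x y : A.

Lemma homomorphism_odot x y : f (x ⊙ y) = f x ⊙ f y.
Proof. by case: fH => _ _ fD fl fr; rewrite !odotE fr fD !fl. Qed.

Lemma homomorphism_meet x y : f (meet x y) = meet (f x) (f y).
Proof. by case: fH => _ _ fD fl _; rewrite /meet homomorphism_odot fD fl. Qed.

Lemma homomorphism_le x y : x ≤ y -> f x ≤ f y.
Proof. by move=> xy; rewrite /le -homomorphism_meet xy. Qed.

Definition kernel : set A := [set x | f x = 0]%classic.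

Lemma kernel_ideal : ideal kernel.
Proof.
case: fH => f0 _ fD _ _; split=> [|x y xy y0|x y x0 y0].
- by exists 0.
- by apply: le0_eq; rewrite -y0; exact: homomorphism_le.
- by rewrite /kernel /= fD x0 y0 oplusx0.
Qed.

Lemma kernel_normal : normal kernel.
Proof.
case: fH => f0 _ fD fl fr x; apply/seteqP; split=> _ [i i0 <-].
(* Adding [x] on the right of this witness gives the join of [x ⊕ i] and [x], which is [x ⊕ i]; its
   image is [f x ⊙ lneg (f x) = 0]. The other inclusion is the mirror image. *)
- exists ((x ⊕ i) ⊙ lneg x).
    by rewrite /kernel /= homomorphism_odot fD i0 oplusx0 fl odot_lneg.
  by rewrite -joinE; apply: join_lel; exact: le_addl.
- exists (rneg x ⊙ (i ⊕ x)).
    by rewrite /kernel /= homomorphism_odot fD i0 oplus0x fr rneg_odotx.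
  by rewrite -/(join x (i ⊕ x)); apply: join_ler; exact: le_addr.
Qed.

Definition kernel_normalIdeal := NormalIdeal kernel_ideal kernel_normal.

(** In a chain the meet of two elements is one of them. *)
Lemma kernel_prime : linearly_ordered B -> prime_ideal kernel.
Proof.
move=> Blin; split; first exact: kernel_ideal.
move=> x y; rewrite /kernel /= homomorphism_meet => xy0.
by case: (Blin (f x) (f y)) => [<-|<-]; [left|right; rewrite meetC].
Qed.

End Kernel.

(** The square of [r x] is [x ≤ y], and [r y] dominates every element whose square is below [y]. *)
Lemma square_root_le (M : pseudoMVType) (r : M -> M) (x y : M) :
  square_root r -> x ≤ y -> r x ≤ r y.
Proof. by case=> rr r_max _ xy; apply: r_max; rewrite rr. Qed.

Theorem theorem5p10 (M : pseudoMVType) (Mrep : representable M)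
  (Mstrict : strict M) : strongly_atomless M.
Proof.
case: Mrep => J [A [h [Alin hH h_inj _]]] x x0.
have [j hx0] : exists j, h x j <> 0.
  (* If every coordinate of [h x] vanished, [h x] would equal [h 0], and injectivity would give
     [x = 0]. *)
  apply: contra_notP x0 => /forallNP hx.
  apply/h_inj/functional_extensionality_dep => j.
  by case: (hH j) => -> *; exact: contrapT (hx j).
exists (kernel_normalIdeal (hH j)); split=> //; first exact: kernel_prime.
case: Mstrict => r [rsq rE]; have [rr _ _] := rsq.
set P := kernel_normalIdeal _; have qH := qclass_homomorphism P.
rewrite -(rr x) (homomorphism_odot qH).
apply: (@odot_self_not_atom _ (qclass P (r 0))).
  by case: qH => _ _ _ <- _; rewrite -rE.
apply: (homomorphism_le qH); apply: square_root_le => //; exact: le0x.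
Qed.
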